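(* Let $n\ge2$ and let $\kappa=(\kappa_1,\dots,\kappa_n)\in\mathbb R_{<0}^n$ be such that $$\overline\Delta=\overline\Delta_{(n,n+1)}(\kappa)=\{x\in\mathbb R^2:\ x_1\ge0,\ \ell_j^{\kappa_j}(x)\ge0\ (1\le j\le n),\ -nx_1+(n+1)x_2\ge0\},\qquad \ell_j^{\kappa_j}(x)=-(j-1)x_1+jx_2+\kappa_j,$$ is a minimal resolution (of the $A_n$-singularity), i.e. has $n+2$ edges. A point $x\in\mathrm{Int}\,\overline\Delta$ is displaceable by probes or extended probes if it does not belong to one of the $n-1$ rays given by $$\ell_j^{\kappa_j}(x)=\ell_{j+1}^{\kappa_{j+1}}(x)\quad\text{and}\quad \ell_j^{\kappa_j}(x)\ge\max\{\ell_j^{\kappa_j}(y): y\in\overline\Delta,\ \ell_{j+1}^{\kappa_{j+1}}(y)=0\}$$ for $j=1,\dots,n-1$.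
   Context: $\overline\Delta$ is a smooth polygon; let $(\overline M,\overline\omega,\overline\Phi)$ be the symplectic toric manifold with $\overline\Phi(\overline M)=\overline\Delta$ and $L_x=\overline\Phi^{-1}(x)$. A set $X$ is displaceable if some compactly supported Hamiltonian diffeomorphism $\phi$ satisfies $\phi(X)\cap\overline X=\emptyset$. Probes and extended probes in a rational polygon $\Delta$ (facets $F\subset\{\langle\eta_F,x\rangle+\kappa_F=0\}$, $\eta_F$ primitive interior conormal). If $x-y=tv$ with $v$ primitive integral, $d_{\mathrm{aff}}(x,y)=|t|$; $d_{\mathrm{aff}}(x,F)=|\langle\eta_F,x\rangle+\kappa_F|$. A probe $P$ is a directed segment in $\Delta$ from $b_P$ in the interior of a facet $F_P$ to $b_P+\ell(P)v_P$, with $v_P\in\mathbb Z^2$ primitive and $\langle\eta_{F_P},v_P\rangle=1$; $\ell(P)$ is its length. A point $u\in\mathrm{Int}\,\Delta$ is displaceable by probes or extended probes if one of the following holds (each implies that $L_u$ is displaceable): (a) $u\in P$ for a probe $P$ and $d_{\mathrm{aff}}(u,F_P)<\frac12\ell(P)$. (b) There are a symmetric probe $Q$ (its endpoint lies in the interior of a facet $F_Q'$ with $\langle\eta_{F_Q'},v_Q\rangle=-1$), with affine reflection $A_Q(x)=x+\langle\eta_{F_Q'}-\eta_{F_Q},x\rangle v_Q+(\kappa_{F_Q'}-\kappa_{F_Q})v_Q$ and linear part $\widehat A_Q$, a probe $P$ ending at $x_{PQ}$ in the interior of $Q$, and a segment $P'\subset\Delta$ from $x_{PQ}'=A_Q(x_{PQ})$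 to $x'_{PQ}+\ell(P')\widehat A_Q(v_P)$, such that either $u\in\mathrm{Int}\,P$ and $d_{\mathrm{aff}}(u,F_P)<\frac12(\ell(P)+\ell(P'))$, or $u\in\mathrm{Int}\,P'$ and $\ell(P)+d_{\mathrm{aff}}(x'_{PQ},u)<\frac12(\ell(P)+\ell(P'))$ (symmetric extended probe). (c) There are probes $P,Q$ with $P$ ending at $x_{PQ}\in Q$ and $v_P$ parallel to $F_Q$, points $x_{\mathcal F},x_{\mathcal F}'\in Q$ and $\ell(\mathcal F)\ge0$ such that the convex hull of $x_{\mathcal F},x'_{\mathcal F},x_{\mathcal F}+\ell(\mathcal F)v_P,x'_{\mathcal F}+\ell(\mathcal F)v_P$ lies in $\Delta$, $u\in\mathrm{Int}\,P$, $d_{\mathrm{aff}}(u,F_P)<\frac12(\ell(P)+\ell(\mathcal F))$ and $d_{\mathrm{aff}}(x_{PQ},F_Q)<d_{\mathrm{aff}}(x_{\mathcal F},x'_{\mathcal F})$ (parallel extended probe with flag). *)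

(* Defs.v *)
From HB Require Import structures.
From mathcomp Require Import all_boot all_order all_algebra.
From mathcomp Require Import all_classical all_reals all_analysis.

Set Implicit Arguments.
Unset Strict Implicit.
Unset Printing Implicit Defensive.

Import Order.TTheory GRing.Theory Num.Theory.
Import numFieldNormedType.Exports.

Local Open Scope classical_set_scope.
Local Open Scope ring_scope.

Section Defs.
Variable R : realType.

Notation point := 'rV[R]_2.
Notation lattice := 'rV[int]_2.

Implicit Types (Delta : set point) (x y b w : point) (v eta : lattice).

Definition vec v : point := map_mx intr v.

Definition primitive v : bool := coprimez (v 0 0) (v 0 1).

Definition pairing eta x : R := \sum_i (eta 0 i)%:~R * x 0 i.

(* The affine function x |-> <eta, x> + kappa, given by (eta, kappa). *)
Record affine_form := AffineForm { conormal : lattice; offset : R }.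

Implicit Types F : affine_form.

Definition form_val F x : R := pairing (conormal F) x + offset F.

Definition line F : set point := [set x | form_val F x = 0].

(* A facet is represented by its primitive interior conormal and its constant;
   the facet as a subset of the plane is Delta `&` line F, and the last clause
   says that this subset is one-dimensional.  For Delta a polygon with
   non-empty interior, F is determined by Delta `&` line F. *)
Definition is_facet Delta F : Prop :=
  [/\ primitive (conormal F),
      (forall x, Delta x -> 0 <= form_val F x) &
      exists x y, [/\ x != y, (Delta `&` line F) x & (Delta `&` line F) y]].

Definition edges Delta : set (set point) :=
  [set Delta `&` line F | F in is_facet Delta].

(* Interior relative to the supporting line; since the line contains x, the
   second condition includes Delta x. *)
Definition facet_interior Delta F : set point :=
  [set x | line F x /\ within (line F) (nbhs x) Delta].

Definition segment b w (l : R) : set point := [set b + t *: w | t in `[0, l]].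

Definition open_segment b w (l : R) : set point :=
  [set b + t *: w | t in `]0, l[].

Definition convex_hull (S : set point) : set point := smallest (@convex_set R point) S.

(* [affine_dist x y d] means d_aff(x, y) = d; such a d exists only when the
   line through x and y has rational direction, and it is then unique because
   a primitive vector is determined up to sign by the line it spans. *)
Definition affine_dist x y (d : R) : Prop :=
  exists t v, [/\ primitive v, x - y = t *: vec v & d = `|t|].

Definition affine_dist_facet x F : R := `|form_val F x|.

Record probe := Probe {
  base_facet : affine_form;
  base : point;
  direction : lattice;
  length : R }.

Implicit Types P Q : probe.

Definition probe_set P : set point :=
  segment (base P) (vec (direction P)) (length P).

Definition probe_interior P : set point :=
  open_segment (base P) (vec (direction P)) (length P).

Definition endpoint P : point := base P + length P *: vec (direction P).

Definition is_probe Delta P : Prop :=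
  [/\ is_facet Delta (base_facet P) /\
        facet_interior Delta (base_facet P) (base P),
      primitive (direction P),
      pairing (conormal (base_facet P)) (vec (direction P)) = 1,
      0 < length P &
      probe_set P `<=` Delta].

Definition is_symmetric_probe Delta Q F' : Prop :=
  [/\ is_probe Delta Q, is_facet Delta F',
      facet_interior Delta F' (endpoint Q) &
      pairing (conormal F') (vec (direction Q)) = - 1].

Definition reflection_linear Q F' w : point :=
  w + pairing (conormal F' - conormal (base_facet Q)) w *: vec (direction Q).

Definition reflection Q F' x : point :=
  x + pairing (conormal F' - conormal (base_facet Q)) x *: vec (direction Q)
    + (offset F' - offset (base_facet Q)) *: vec (direction Q).

Definition displaceable_by_probe Delta (u : point) : Prop :=
  exists P, [/\ is_probe Delta P, probe_set P u &
    affine_dist_facet u (base_facet P) < length P / 2].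

(* F' is the facet containing the endpoint of Q, and the segment P' starts at
   x', the reflection of the endpoint x_PQ of P, with direction w' and
   length l'. *)
Definition displaceable_by_symmetric_extended_probe Delta (u : point) : Prop :=
  exists Q F' P (l' : R),
  let x' := reflection Q F' (endpoint P) in
  let w' := reflection_linear Q F' (vec (direction P)) in
  [/\ is_symmetric_probe Delta Q F',
      is_probe Delta P,
      probe_interior Q (endpoint P),
      0 < l' /\ segment x' w' l' `<=` Delta &
      (probe_interior P u /\
         affine_dist_facet u (base_facet P) < (length P + l') / 2) \/
      (open_segment x' w' l' u /\
         exists2 d, affine_dist x' u d & length P + d < (length P + l') / 2)].

(* xF, xF' and lF are the two corners on Q and the length of the flag. *)
Definition displaceable_by_parallel_extended_probe Delta (u : point) : Prop :=
  exists P Q xF xF' (lF : R),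
  [/\ [/\ is_probe Delta P, is_probe Delta Q, probe_set Q (endpoint P) &
          pairing (conormal (base_facet Q)) (vec (direction P)) = 0],
      [/\ probe_set Q xF, probe_set Q xF' & 0 <= lF],
      convex_hull [set xF; xF'; xF + lF *: vec (direction P);
                        xF' + lF *: vec (direction P)]
        `<=` Delta,
      probe_interior P u /\
        affine_dist_facet u (base_facet P) < (length P + lF) / 2 &
      exists2 d, affine_dist xF xF' d &
        affine_dist_facet (endpoint P) (base_facet Q) < d].

Definition displaceable_by_probes_or_extended_probes Delta (u : point) : Prop :=
  interior Delta u /\
  [\/ displaceable_by_probe Delta u,
      displaceable_by_symmetric_extended_probe Delta u |
      displaceable_by_parallel_extended_probe Delta u].

Definition ell (j : nat) (c : R) x : R :=
  - (j%:R - 1) * x 0 0 + j%:R * x 0 1 + c.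

(* The vector kappa is indexed from 0, so that ell_j^{kappa_j} for
   1 <= j <= n is [ellk kappa i] with i = j - 1. *)
Definition ellk n (kappa : 'rV[R]_n) (i : 'I_n) : point -> R :=
  ell i.+1 (kappa 0 i).

Definition resolution_polygon n (kappa : 'rV[R]_n) : set point :=
  [set x : point | [/\ 0 <= x 0 0, (forall i, 0 <= ellk kappa i x) &
               0 <= - n%:R * x 0 0 + n.+1%:R * x 0 1]].

Definition is_maximum (A : set R) (m : R) : Prop := A m /\ ubound A m.

(* Meant for k = i + 1 only. *)
Definition exceptional_ray n (kappa : 'rV[R]_n) (i k : 'I_n) : set point :=
  [set x : point | ellk kappa i x = ellk kappa k x /\
     exists2 m,
       is_maximum [set ellk kappa i y |
                   y in [set y : point | resolution_polygon kappa y /\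
                                 ellk kappa k y = 0]] m &
       m <= ellk kappa i x].

End Defs.

(* Main.v *)
Require Import Defs.
From HB Require Import structures.
From mathcomp Require Import all_boot all_order all_algebra.
From mathcomp Require Import all_classical all_reals all_analysis.
From mathcomp Require Import ring lra zify.

Import Order.TTheory GRing.Theory Num.Theory.
Import numFieldNormedType.Exports.

Local Open Scope classical_set_scope.
Local Open Scope ring_scope.

(** With kappa_0 = kappa_(n+1) = 0, the two unbounded edges of the polygon belong
    to the same family as the others: in the unimodular coordinates x_1 and
    s = x_2 - x_1, the facet forms are f_j = x_1 + j s + kappa_j for
    0 <= j <= n+1.  The polygon is therefore the region above the graph of a
    convex piecewise linear function of s, whose break points are among the
    s_j = kappa_j - kappa_(j+1), 0 <= j <= n.  Having n+2 edges means that
    every f_j vanishes along an edge, that is, s_0 > s_1 > ... > s_n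
    ([chain_decreasing]); facet j then lies over [s_j, s_(j-1)] and f_j is the
    least of the forms there ([chain_lt]).

    The direction e with s constant and x_1 increasing satisfies
    <eta_j, e> = 1 for all j and never leaves the polygon, so it gives probes
    of arbitrary length from every facet.  They displace each interior point
    whose s differs from all s_j ([transversal_probe]).

    Let u lie over s_j, at height h = f_j(u) = f_(j+1)(u).  Let w be the
    direction parallel to facet j which leaves facet j+1 at unit speed.  If
    u - h w is in the interior of facet j+1, a probe P starts there, passes
    through u and can be stopped just beyond u at a probe Q of direction e from
    facet j.  The polygon contains translates by multiples of e of any bounded
    set, so arbitrarily large flags in direction w sit high enough on Q, and
    the parallel extended probe displaces u ([flag_over_transversal_probe]).
    Now u - h w lies over s_j - h, so the requirement is h < s_j - s_(j+1),
    which is void for j = n as facet n+1 is unbounded.  For j = 0 the roles of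
    the two facets are exchanged, the base of P being then on the unbounded
    facet 0.  For 1 <= j <= n-1, the number s_j - s_(j+1) is the maximum of
    f_j over facet j+1, attained at the vertex over s_(j+1); so the points left
    over are exactly those of the rays ([exceptional_ray_chain]). *)

(** * Affine forms in the plane *)

Section AffineForms.
Context {R : realType}.
Implicit Types (Delta : set 'rV[R]_2) (x y z b u : 'rV[R]_2).
Implicit Types (v w e eta : 'rV[int]_2) (F G : affine_form R).

Lemma pairingE eta x :
  pairing eta x = (eta 0 0)%:~R * x 0 0 + (eta 0 1)%:~R * x 0 1.
Proof.
rewrite /pairing !big_ord_recl big_ord0 addr0.
by rewrite (_ : lift ord0 ord0 = 1) //; apply/val_inj.
Qed.

Lemma point_eq x y : x 0 0 = y 0 0 -> x 0 1 = y 0 1 -> x = y.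
Proof.
move=> e0 e1; apply/rowP => -[[|[|//]] lt].
- by rewrite (_ : Ordinal lt = 0) //; apply/val_inj.
- by rewrite (_ : Ordinal lt = 1) //; apply/val_inj.
Qed.

Lemma form_val_line F x t (w : 'rV[R]_2) :
  form_val F (x + t *: w) = form_val F x + t * pairing (conormal F) w.
Proof. by rewrite /form_val !pairingE !mxE; ring. Qed.

Lemma continuous_form_val F : continuous (form_val F : 'rV[R]_2 -> R).
Proof.
move=> x; rewrite (_ : form_val F = fun y =>
    (conormal F 0 0)%:~R * y 0 0 + (conormal F 0 1)%:~R * y 0 1 + offset F);
  last first.
  by apply/funext => y; rewrite /form_val pairingE.
have c (a : R) (j : 'I_2) :
    (fun y : 'rV[R]_2 => a * y 0 j) @ nbhs x --> a * x 0 j.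
  by apply: cvgMl_tmp; exact: coord_continuous.
exact: cvgD (cvgD (c _ 0) (c _ 1)) (cvg_cst _).
Qed.

Lemma nbhs_line x (w : 'rV[R]_2) (A : set 'rV[R]_2) :
  nbhs x A -> exists2 t, 0 < t & A (x + t *: w).
Proof.
move=> nA.
have c : (fun t : R => x + t *: w) @ (0 : R) --> x.
  rewrite -[X in _ --> X]addr0 -[X in _ --> x + X](scale0r w).
  by apply: cvgD; [exact: cvg_cst|apply: cvgZr_tmp; exact: cvg_id].
have /nbhs_ballP[/= r r0 rA] := c _ nA.
exists (r / 2); first by rewrite divr_gt0.
apply: rA; rewrite /ball /= sub0r normrN gtr0_norm ?divr_gt0 //.
by rewrite ltr_pdivrMr // mulr_natr mulr2n ltrDl.
Qed.

Lemma primitive_gt0 eta : primitive eta -> 0 < pairing eta (vec R eta) :> R.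
Proof.
move=> pr; rewrite pairingE !mxE -!expr2.
rewrite lt_neqAle addr_ge0 ?sqr_ge0 // andbT eq_sym.
rewrite paddr_eq0 ?sqr_ge0 // !sqrf_eq0 !intr_eq0.
apply/negP => /andP[/eqP e0 /eqP e1].
by move: pr; rewrite /primitive e0 e1.
Qed.

(** At a zero in the interior, moving against the conormal would make the form
    negative. *)
Lemma interior_form_val_gt0 Delta G x : primitive (conormal G) ->
  (forall y, Delta y -> 0 <= form_val G y) -> interior Delta x ->
  0 < form_val G x.
Proof.
move=> /primitive_gt0 pr G0 Dx.
have [t t0 /G0] := @nbhs_line x (- vec R (conormal G)) Delta Dx.
rewrite form_val_line.
rewrite (_ : pairing _ _ = - pairing (conormal G) (vec R (conormal G))).
  by rewrite mulrN subr_ge0; apply: lt_le_trans; rewrite mulr_gt0.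
by rewrite !pairingE !mxE; ring.
Qed.

(** The vectors x - y and z - y are both orthogonal to the conormal of F, so
    their determinant D vanishes; D = 0 and the vanishing of G at y and z force
    G(x) (z - y) = 0. *)
Lemma line_two_points F G y z : primitive (conormal F) -> y != z ->
  line F y -> line F z -> line G y -> line G z -> line F `<=` line G.
Proof.
move=> /primitive_gt0 pr yz; rewrite /line /= /form_val => Fy Fz Gy Gz x /= Fx.
move: pr Fy Fz Gy Gz Fx; rewrite !pairingE !mxE.
set a := _%:~R; set b := _%:~R; set c := _%:~R; set d := _%:~R.
move=> pr Fy Fz Gy Gz Fx.
pose D := (x 0 0 - y 0 0) * (z 0 1 - y 0 1) - (x 0 1 - y 0 1) * (z 0 0 - y 0 0).
have D0 : D = 0.
  have : (a * a + b * b) * D = 0.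
    rewrite (_ : _ * D =
      (a * (z 0 1 - y 0 1) - b * (z 0 0 - y 0 0)) *
         ((a * x 0 0 + b * x 0 1 + offset F) - (a * y 0 0 + b * y 0 1 + offset F))
      + (b * (x 0 0 - y 0 0) - a * (x 0 1 - y 0 1)) *
         ((a * z 0 0 + b * z 0 1 + offset F) - (a * y 0 0 + b * y 0 1 + offset F)));
      last by rewrite /D; ring.
    by rewrite Fx Fy Fz subrr !mulr0 addr0.
  by move/eqP; rewrite mulf_eq0 (gt_eqF pr) => /eqP.
set g := LHS.
have g0 : g * (z 0 0 - y 0 0) = 0.
  rewrite (_ : _ * _ = - d * D
     + (x 0 0 - y 0 0) * ((c * z 0 0 + d * z 0 1 + offset G)
                          - (c * y 0 0 + d * y 0 1 + offset G))
     + (z 0 0 - y 0 0) * (c * y 0 0 + d * y 0 1 + offset G)); last by rewrite /g /D; ring.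
  by rewrite D0 Gz Gy; ring.
have g1 : g * (z 0 1 - y 0 1) = 0.
  rewrite (_ : _ * _ = c * D
     + (x 0 1 - y 0 1) * ((c * z 0 0 + d * z 0 1 + offset G)
                          - (c * y 0 0 + d * y 0 1 + offset G))
     + (z 0 1 - y 0 1) * (c * y 0 0 + d * y 0 1 + offset G)); last by rewrite /g /D; ring.
  by rewrite D0 Gz Gy; ring.
apply/eqP; apply: contraT => gn0; move: yz; rewrite (_ : y = z) ?eqxx //.
by apply: point_eq; apply/eqP; rewrite eq_sym -subr_eq0;
  [move/eqP: g0|move/eqP: g1]; rewrite mulf_eq0 (negbTE gn0).
Qed.

End AffineForms.

(** * Facets and probes of an intersection of half-planes *)

Section Polyhedra.
Context {R : realType} {I : finType}.
Context (F : I -> affine_form R).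
Implicit Types (x y z b u : 'rV[R]_2) (v w e : 'rV[int]_2) (i k m : I).

Definition polyhedron : set 'rV[R]_2 := [set x | forall i, 0 <= form_val (F i) x].

Definition relative_interior i b :=
  form_val (F i) b = 0 /\ forall k, k != i -> 0 < form_val (F k) b.

Lemma near_form_val_gt (A : pred I) (c : R) x :
  (forall i, A i -> c < form_val (F i) x) ->
  \forall y \near x, forall i, A i -> c < form_val (F i) y.
Proof.
move=> cx; apply: (@filter_forall _ _
  (fun i => [set y | A i -> c < form_val (F i) y]) (nbhs x) _) => i.
case: (boolP (A i)) => Ai; last by apply: filterE.
apply: filterS (cvgr_gt _ (continuous_form_val (F i) x) _ (cx i Ai)).
by move=> y cy _.
Qed.

Lemma polyhedron_interior x : (forall i, 0 < form_val (F i) x) -> interior polyhedron x.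
Proof.
move=> x0; have := @near_form_val_gt predT 0 x (fun i _ => x0 i).
by apply: filterS => y y0 i; apply/ltW/y0.
Qed.

Lemma polyhedron_convex : convex_set (polyhedron : set (convex_lmodType 'rV[R]_2)).
Proof.
move=> x y l; rewrite !inE => Px Py i.
have l0 : 0 <= l%:num by [].
have l1 : l%:num <= 1 by [].
rewrite (_ : form_val _ _ = l%:num * form_val (F i) x + (1 - l%:num) * form_val (F i) y).
  by rewrite addr_ge0 // mulr_ge0 ?subr_ge0.
by rewrite /form_val !pairingE !mxE /unstable.onem; ring.
Qed.

Lemma polyhedron_hull (S : set 'rV[R]_2) :
  S `<=` polyhedron -> convex_hull S `<=` polyhedron.
Proof. exact: smallest_sub polyhedron_convex. Qed.

Lemma polyhedron_segment b (w : 'rV[R]_2) l : 0 < l -> polyhedron b ->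
  polyhedron (b + l *: w) -> segment b w l `<=` polyhedron.
Proof.
move=> l0 Pb Pe _ [t /= + <-] i; rewrite in_itv /= => /andP[t0 tl].
move: (Pb i) (Pe i); rewrite !form_val_line => bi ei.
rewrite -(pmulr_rge0 _ l0).
rewrite (_ : l * _ = (l - t) * form_val (F i) b +
   t * (form_val (F i) b + l * pairing (conormal (F i)) w)); last by ring.
by rewrite addr_ge0 // mulr_ge0 // subr_ge0.
Qed.

(** Near b only the i-th inequality can fail, so the line of F i stays in the
    polyhedron there; moving along it from b gives the second point required of
    a facet. *)
Lemma relative_interior_facet i b : primitive (conormal (F i)) ->
  relative_interior i b ->
  is_facet polyhedron (F i) /\ facet_interior polyhedron (F i) b.
Proof.
move=> pr [b0 bk].
have nb : \forall y \near b, line (F i) y -> polyhedron y.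
  have := @near_form_val_gt [pred k | k != i] 0 b bk.
  apply: filterS => y y0 yi k; case: (eqVneq k i) => [->|/y0/ltW //].
  by rewrite yi.
split; last by split.
split=> [//|x Px|]; first exact: Px.
pose w : 'rV[R]_2 := \row_j (if j == 0 then - (conormal (F i) 0 1)%:~R
                                        else (conormal (F i) 0 0)%:~R).
have [t t0 wt] := nbhs_line _ w _ nb.
have l0 : line (F i) (b + t *: w).
  by rewrite /line /= form_val_line b0 pairingE !mxE /=; ring.
exists (b + t *: w), b; split; first 1 last.
- by split=> //; exact: wt.
- split=> //; exact: (nbhs_singleton nb b0).
rewrite -subr_eq0 addrAC subrr add0r scaler_eq0 gt_eqF //=.
apply/eqP => w0; have := primitive_gt0 _ pr (R := R).
rewrite pairingE !mxE.
move/rowP: w0 => w0; have := w0 0; have := w0 1; rewrite !mxE /=.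
by move=> -> /eqP; rewrite oppr_eq0 => /eqP ->; rewrite !mul0r addr0 ltxx.
Qed.

Lemma probe_from_facet i b v l : primitive (conormal (F i)) ->
  relative_interior i b -> primitive v ->
  pairing (conormal (F i)) (vec R v) = 1 -> 0 < l ->
  polyhedron (b + l *: vec R v) -> is_probe polyhedron (Probe (F i) b v l).
Proof.
move=> pri ib prv iv l0 Pe; split=> //=; first exact: relative_interior_facet.
apply: polyhedron_segment => // k; case: (eqVneq k i) => [->|/(ib.2 k)/ltW //].
by rewrite ib.1.
Qed.

(** The midpoint of two points of a facet is not an interior point, so some
    F i is not positive at it; F i being nonnegative at both ends, it vanishes
    there too, and the two lines agree. *)
Lemma facet_polyhedron G : (forall i, primitive (conormal (F i))) ->
  is_facet polyhedron G ->
  exists i, line G = line (F i) /\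
    exists y z, [/\ y != z, (polyhedron `&` line (F i)) y
                         & (polyhedron `&` line (F i)) z].
Proof.
move=> prF [prG G0 [y [z [yz [Py Gy] [Pz Gz]]]]].
pose m := y + 2^-1 *: (z - y).
have fm H : form_val H m = (form_val H y + form_val H z) / 2.
  by rewrite /m form_val_line /form_val !pairingE !mxE; field.
have Gm : form_val G m = 0 by rewrite fm Gy Gz addr0 mul0r.
have [[i im]|nm] := pselect (exists i, form_val (F i) m <= 0); last first.
  have : 0 < form_val G m.
    apply: (@interior_form_val_gt0 _ polyhedron) => //.
    apply: polyhedron_interior => i; rewrite ltNge; apply/negP => im.
    by apply: nm; exists i.
  by rewrite Gm ltxx.
have Fy : line (F i) y.
  by rewrite /line /=; move: im (Py i) (Pz i); rewrite fm; lra.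
have Fz : line (F i) z.
  by rewrite /line /=; move: im (Py i) (Pz i); rewrite fm; lra.
exists i; split; last by exists y, z.
by rewrite eqEsubset; split; apply: (@line_two_points _ _ _ y z).
Qed.

(** Every edge is cut out by some F k that vanishes at two points of the
    polyhedron; if F i did not, there would be fewer edges than forms. *)
Lemma edges_count_two_points i : (forall i, primitive (conormal (F i))) ->
  (edges polyhedron #= `I_#|I|)%card ->
  exists y z, [/\ y != z, (polyhedron `&` line (F i)) y
                         & (polyhedron `&` line (F i)) z].
Proof.
move=> prF ec; apply: contrapT => ni.
pose s := enum (predC1 i); pose f j := polyhedron `&` line (F (nth i s j)).
have : edges polyhedron `<=` f @` `I_#|I|.-1.
  move=> _ [G /(facet_polyhedron _ prF)[k [Gk yz]] <-].
  have ks : k \in s.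
    by rewrite mem_enum !inE; apply/eqP => ki; apply: ni; rewrite -ki.
  exists (index k s); last by rewrite /f nth_index // Gk.
  by rewrite /= -(cardC1 i) cardE index_mem.
move=> /subset_card_le/card_le_trans/(_ (card_image_le _ _)).
move: ec => /card_eqPle[_ /card_le_trans] /[apply].
rewrite card_le_II; have : (0 < #|I|)%N by apply/card_gt0P; exists i.
by case: #|I| => //= N _; rewrite ltnn.
Qed.

(** A direction e of slope 1 for all the forms at once never leaves the
    polyhedron, so the probe through u from the facet nearest to u may be taken
    longer than twice its distance from u. *)
Lemma transversal_probe i u e : (forall k, primitive (conormal (F k))) ->
  primitive e -> (forall k, pairing (conormal (F k)) (vec R e) = 1) ->
  0 < form_val (F i) u -> (forall k, k != i -> form_val (F i) u < form_val (F k) u) ->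
  displaceable_by_probe polyhedron u.
Proof.
move=> prF pre e1 u0 ui; set h := form_val (F i) u in u0 ui.
have hE k t : form_val (F k) (u + t *: vec R e) = form_val (F k) u + t.
  by rewrite form_val_line e1 mulr1.
exists (Probe (F i) (u + (- h) *: vec R e) e (2 * h + 1)); split => /=.
- apply: probe_from_facet => //; last 2 first.
  + by lra.
  + move=> k; rewrite -addrA -scalerDl hE.
    by case: (eqVneq k i) => [->|/ui]; rewrite -/h; lra.
  by split=> [|k /ui]; rewrite hE -/h; lra.
- exists h => /=; first by rewrite in_itv /=; apply/andP; split; lra.
  by rewrite -addrA -scalerDl addNr scale0r addr0.
- by rewrite /affine_dist_facet -/h gtr0_norm //; lra.
Qed.

(** The probe P goes from facet i in direction w through u, and Q goes from
    facet k in direction e.  Since w is parallel to facet k, the end of P has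
    the same height over facet k as u has.  Raising the flag along Q costs
    nothing, because all forms increase along e; its length in direction w and
    its extent along Q may therefore be chosen freely. *)
Lemma flag_over_transversal_probe i k u e w :
  (forall m, primitive (conormal (F m))) ->
  primitive e -> (forall m, pairing (conormal (F m)) (vec R e) = 1) ->
  primitive w -> pairing (conormal (F i)) (vec R w) = 1 ->
  pairing (conormal (F k)) (vec R w) = 0 ->
  0 < form_val (F k) u ->
  (forall m, m != i -> m != k -> form_val (F k) u < form_val (F m) u) ->
  relative_interior i (u - form_val (F k) u *: vec R w) ->
  displaceable_by_parallel_extended_probe polyhedron u.
Proof.
move=> prF pre e1 prw wi wk; set h := form_val (F k) u => h0 uh ib.
pose W := vec R w; pose E := vec R e.
have ui : form_val (F i) u = h.
  by move: ib.1; rewrite -scaleNr form_val_line wi mulr1; lra.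
(* P ends at u + eps *: W: beyond u, yet before any other form drops to h. *)
have [eps eps0 uW] : exists2 eps, 0 < eps & forall m, (m != i) && (m != k) ->
    h < form_val (F m) (u + eps *: W).
  apply: (nbhs_line _ W [set y | forall m, _ -> h < form_val (F m) y]).
  by apply: near_form_val_gt => m /andP[]; exact: uh.
have kW : form_val (F k) (u + eps *: W) = h by rewrite form_val_line wk mulr0 addr0.
have mW m : m != k -> h < form_val (F m) (u + eps *: W).
  case: (eqVneq m i) => [-> _|mi mk]; last by rewrite uW // mi.
  by rewrite form_val_line ui wi; lra.
(* The foot of Q, on facet k below the end of P. *)
pose q := u + eps *: W + (- h) *: E.
have FE m y t : form_val (F m) (y + t *: E) = form_val (F m) y + t.
  by rewrite form_val_line e1 mulr1.
have kq : relative_interior k q by split=> [|m /mW]; rewrite FE ?kW; lra.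
have q0 m : 0 <= form_val (F m) q.
  by case: (eqVneq m k) => [->|/kq.2/ltW//]; rewrite kq.1.
(* High enough for a displacement by h *: W to stay in the polyhedron. *)
pose H := h * \sum_m `|pairing (conormal (F m)) W|.
have Hw m : h * `|pairing (conormal (F m)) W| <= H.
  by rewrite ler_pM2l // (bigD1 m) //= lerDl sumr_ge0.
have H0 : 0 <= H by rewrite mulr_ge0 ?sumr_ge0 // ltW.
have Hpos m t : H <= t -> 0 <= form_val (F m) (q + t *: E).
  by move=> Ht; rewrite FE; have := q0 m; lra.
have HposW m t : H <= t -> 0 <= form_val (F m) (q + t *: E + h *: W).
  move=> Ht; rewrite form_val_line FE.
  have := q0 m; have := Hw m; have := ler_norm (- pairing (conormal (F m)) W).
  by rewrite normrN -(ler_pM2l h0) mulrN; lra.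
exists (Probe (F i) (u - h *: W) w (h + eps)), (Probe (F k) q e (H + h + 1)).
(* The flag has length h, and its extent h + 1 along Q exceeds the height h of
   the end of P. *)
exists (q + H *: E), (q + (H + h + 1) *: E), h.
have endP : u - h *: W + (h + eps) *: W = u + eps *: W.
  by rewrite -scaleNr -addrA -scalerDl addKr.
rewrite /endpoint /= endP; split.
- split=> //.
  + apply: probe_from_facet => //; first by lra.
    rewrite endP => m; case: (eqVneq m k) => [->|/mW]; last by lra.
    by rewrite kW ltW.
  + apply: probe_from_facet => //; first by lra.
    by move=> m; apply: Hpos; lra.
  + exists h => /=; first by rewrite in_itv /=; apply/andP; split; lra.
    by rewrite /q scaleNr subrK.
- by split; [exists H|exists (H + h + 1)|] => //=; rewrite ?in_itv /=; lra.
- apply: polyhedron_hull => x [[[]|]|] -> m.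
  + exact: Hpos.
  + by apply: Hpos; lra.
  + exact: HposW.
  + by apply: HposW; lra.
- rewrite /affine_dist_facet ui gtr0_norm //; split; last by lra.
  by exists h; [rewrite /= in_itv /=; lra|rewrite subrK].
- exists (h + 1); last by rewrite /affine_dist_facet kW gtr0_norm //; lra.
  exists (- (h + 1)), e; split=> //; last by rewrite normrN gtr0_norm //; lra.
  by rewrite opprD addrACA subrr add0r -scaleNr -scalerDl; congr (_ *: _); lra.
Qed.

End Polyhedra.

(** * The chain of forms x_1 + j (x_2 - x_1) + K_j *)

Section Chain.
Context {R : realType}.
Implicit Types (x y z u : 'rV[R]_2) (K : nat -> R) (N i j m : nat).

Definition lattice_vec (a b : int) : 'rV[int]_2 :=
  \row_j (if j == 0 then a else b).

(** The coordinate s = x_2 - x_1, constant along (1, 1), on which the slopes of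
    the boundary of the polygon depend. *)
Definition shear x : R := x 0 1 - x 0 0.

Definition chain K j : affine_form R := AffineForm (lattice_vec (1 - j%:Z) j%:Z) (K j).

(** The value of the shear at which the forms of index j and j + 1 agree, by
    [chain_succ]. *)
Definition breakpoint K j : R := K j - K j.+1.

Lemma lattice_vec_pairing j a b :
  pairing (lattice_vec (1 - j%:Z) j%:Z) (vec R (lattice_vec a b)) =
  (a + (j%:Z * (b - a)))%:~R.
Proof. by rewrite pairingE !mxE /= !(intrD, intrM, rmorphN) /=; ring. Qed.

Lemma chain_val K j x : form_val (chain K j) x = x 0 0 + j%:R * shear x + K j.
Proof. by rewrite /form_val pairingE /= !mxE /= intrB /shear /= ; ring. Qed.

Lemma primitive_lattice_vec a b (p q : int) :
  p * a + q * b = 1 -> primitive (lattice_vec a b).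
Proof. by move=> pq; rewrite /primitive !mxE /=; apply/coprimezP; exists (p, q). Qed.

Lemma chain_primitive K j : primitive (conormal (chain K j)).
Proof. by apply: (@primitive_lattice_vec _ _ 1 1); ring. Qed.

Lemma chain_succ K j x : form_val (chain K j.+1) x =
  form_val (chain K j) x + (shear x - breakpoint K j).
Proof. by rewrite !chain_val /breakpoint -natr1; ring. Qed.

Definition decreasing_breakpoints K N :=
  forall j, (j.+1 < N)%N -> breakpoint K j.+1 < breakpoint K j.

Lemma chain_lt_right K N i m x : decreasing_breakpoints K N ->
  (i < m <= N)%N -> breakpoint K i < shear x ->
  form_val (chain K i) x < form_val (chain K m) x.
Proof.
move=> dec /andP[im mN] ix.
suff : form_val (chain K i) x < form_val (chain K m) x /\ breakpoint K m.-1 < shear x.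
  by case.
elim: m im mN => // m IH; rewrite ltnS leq_eqVlt => /orP[/eqP <-|im] mN.
  by split=> //; rewrite chain_succ; lra.
have [lt1 lt2] := IH im (ltnW mN).
have mx : breakpoint K m < shear x.
  case: m im mN {IH lt1} lt2 => // m _ mN /=.
  exact: lt_trans (dec _ mN).
by split=> //; rewrite chain_succ; lra.
Qed.

Lemma chain_lt_left K N i m x : decreasing_breakpoints K N ->
  (m < i <= N)%N -> shear x < breakpoint K i.-1 ->
  form_val (chain K i) x < form_val (chain K m) x.
Proof.
move=> dec /andP[mi iN]; rewrite -(subnKC mi) addSn /=.
have : (m + (i - m.+1) < N)%N by rewrite -addSn subnKC.
elim: (i - m.+1)%N => [|d IH]; first by rewrite addn0 chain_succ; lra.
rewrite addnS => dN dx; rewrite chain_succ.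
have := dec _ dN; have := IH (ltnW dN); lra.
Qed.

Lemma chain_lt_breakpoint K N j m x : decreasing_breakpoints K N ->
  (j < N)%N -> (m <= N)%N -> shear x = breakpoint K j -> m != j -> m != j.+1 ->
  form_val (chain K j) x < form_val (chain K m) x.
Proof.
move=> dec jN mN xj mj mj1.
have [mltj|jltm|/eqP] := ltngtP m j; last by rewrite (negbTE mj).
  apply: (@chain_lt_left K N) => //; first by rewrite mltj ltnW.
  by rewrite xj; case: j jN mltj {xj mj mj1} => // j jN _; exact: dec.
have j1m : (j.+1 < m)%N by rewrite ltn_neqAle eq_sym mj1.
apply: le_lt_trans (_ : form_val (chain K j.+1) x < _).
  by rewrite chain_succ xj subrr addr0.
apply: (@chain_lt_right K N) => //; first by rewrite j1m.
by rewrite xj; apply: dec; exact: leq_trans mN.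
Qed.

(** Facet j + 1 lies over [breakpoint K j.+1, breakpoint K j], by comparison with
    the two neighbouring forms; as it has two points, this interval is not
    reduced to a point. *)
Lemma chain_decreasing K N :
  (edges (polyhedron (fun i : 'I_N.+1 => chain K i)) #= `I_N.+1)%card ->
  decreasing_breakpoints K N.
Proof.
move=> ec j jN.
have jN1 : (j.+1 < N.+1)%N by exact: ltnW.
have [|//|y [z [yz [Py Fy] [Pz Fz]]]] :=
    @edges_count_two_points _ _ (fun i : 'I_N.+1 => chain K i) (Ordinal jN1).
- by move=> i; exact: chain_primitive.
- by rewrite card_ord.
move: Fy Fz; rewrite /line /= => Fy Fz.
have bd x : polyhedron (fun i : 'I_N.+1 => chain K i) x ->
    form_val (chain K j.+1) x = 0 ->
    breakpoint K j.+1 <= shear x <= breakpoint K j.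
  move=> Px Fx; have := Px (Ordinal (jN : (j.+2 < N.+1)%N)).
  have := Px (Ordinal (ltnW jN1)).
  by move: Fx; rewrite /= !chain_succ => ? ? ?; apply/andP; split; lra.
have syz : shear y != shear z.
  apply: contra_neq yz => syz; move: Fy Fz; rewrite !chain_val syz => Fy Fz.
  have e0 : y 0 0 = z 0 0 by lra.
  by apply: point_eq => //; move: syz; rewrite /shear e0; lra.
have /andP[y1 y2] := bd y Py Fy; have /andP[z1 z2] := bd z Pz Fz.
by have [lt|lt|/eqP] := ltgtP (shear y) (shear z); [lra|lra|rewrite (negbTE syz)].
Qed.

Lemma chain_lt K N i m x : decreasing_breakpoints K N -> (i <= N)%N -> (m <= N)%N ->
  ((i < N)%N -> breakpoint K i < shear x) ->
  ((0 < i)%N -> shear x < breakpoint K i.-1) ->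
  m != i -> form_val (chain K i) x < form_val (chain K m) x.
Proof.
move=> dec iN mN ix xi; rewrite neq_ltn => /orP[mi|im].
- by apply: (@chain_lt_left K N); rewrite ?mi // xi //; exact: leq_ltn_trans mi.
- by apply: (@chain_lt_right K N); rewrite ?im // ix //; exact: leq_trans mN.
Qed.

Lemma shear_line x t (w : 'rV[R]_2) : shear (x + t *: w) = shear x + t * shear w.
Proof. by rewrite /shear !mxE; ring. Qed.

Lemma shear_vec a b : shear (vec R (lattice_vec a b)) = (b - a)%:~R.
Proof. by rewrite /shear !mxE /= intrB. Qed.

(** Over a break point j > 0 the base of the probe through u is on facet j + 1,
    over breakpoint K j - h where h is the height of u; the bound on h keeps it
    beyond the next break point, if there is one.  Over break point 0 the base is on facet 0,
    over breakpoint K 0 + h, where nothing bounds h. *)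
Theorem chain_displaceable K N u : decreasing_breakpoints K N ->
  interior (polyhedron (fun i : 'I_N.+1 => chain K i)) u ->
  (forall j, (0 < j)%N -> (j.+1 < N)%N -> shear u = breakpoint K j ->
    form_val (chain K j) u < breakpoint K j - breakpoint K j.+1) ->
  displaceable_by_probes_or_extended_probes
    (polyhedron (fun i : 'I_N.+1 => chain K i)) u.
Proof.
move=> dec Pu low; split=> //.
have u0 i : (i <= N)%N -> 0 < form_val (chain K i) u.
  move=> iN; apply: interior_form_val_gt0 Pu; first exact: chain_primitive.
  by move=> y /(_ (Ordinal (iN : (i < N.+1)%N))).
have prF (i : 'I_N.+1) : primitive (conormal (chain K i)) by exact: chain_primitive.
pose e := lattice_vec 1 1.
have pre : primitive e by apply: (@primitive_lattice_vec _ _ 1 0); ring.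
have e1 (i : 'I_N.+1) : pairing (conormal (chain K i)) (vec R e) = 1.
  by rewrite lattice_vec_pairing subrr mulr0 addr0.
have [[j [jN uj]]|nbp] := pselect (exists j, (j < N)%N /\ shear u = breakpoint K j).
- have jN0 : (j < N.+1)%N by exact: ltnW.
  have jN1 : (j.+1 < N.+1)%N by [].
  set h := form_val (chain K j) u.
  have uj1 : form_val (chain K j.+1) u = h by rewrite chain_succ uj subrr addr0.
  have away (m : 'I_N.+1) : m != Ordinal jN0 -> m != Ordinal jN1 ->
      h < form_val (chain K m) u.
    rewrite -!val_eqE /= => mj mj1.
    by apply: (@chain_lt_breakpoint K N); rewrite // -ltnS.
  have baseP (i : 'I_N.+1) x : form_val (chain K i) x = 0 ->
      ((i < N)%N -> breakpoint K i < shear x) ->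
      ((0 < i)%N -> shear x < breakpoint K i.-1) ->
      relative_interior (fun i : 'I_N.+1 => chain K i) i x.
    move=> x0 ix xi; split=> // m; rewrite -val_eqE -x0 => mi.
    by apply: (@chain_lt K N); rewrite // -ltnS.
  have h0 : 0 < h by exact/u0/ltnW.
  constructor 3; case: (posnP j) => [j0|jpos].
  (* From facet 0, parallel to facet 1. *)
  + pose w := lattice_vec 1 0.
    apply: (@flag_over_transversal_probe _ _ _ (Ordinal jN0) (Ordinal jN1) u e w) => //=.
    * by apply: (@primitive_lattice_vec _ _ 1 0); ring.
    * by rewrite lattice_vec_pairing j0 mul0r addr0.
    * by rewrite lattice_vec_pairing j0.
    * by rewrite uj1.
    * by rewrite uj1.
    rewrite uj1 -scaleNr; apply: baseP; rewrite /= ?shear_line ?shear_vec.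
    * by rewrite form_val_line lattice_vec_pairing -/h j0; lra.
    * by rewrite uj; lra.
    * by rewrite j0.
  (* From facet j + 1, parallel to facet j. *)
  + pose w := lattice_vec (- j%:Z) (1 - j%:Z).
    have wE m : pairing (conormal (chain K m)) (vec R w) = m%:R - j%:R.
      by rewrite lattice_vec_pairing !(intrD, intrM, rmorphN) /=; ring.
    apply: (@flag_over_transversal_probe _ _ _ (Ordinal jN1) (Ordinal jN0) u e w) => //=.
    * by apply: (@primitive_lattice_vec _ _ (-1) 1); ring.
    * by rewrite wE -natr1; lra.
    * by rewrite wE subrr.
    * by move=> m mj1 mj; exact: away.
    rewrite -/h -scaleNr; apply: baseP; rewrite /= ?shear_line ?shear_vec.
    * by rewrite form_val_line wE uj1 -natr1; lra.
    * move=> jN2; rewrite uj; have := low j jpos jN2 uj.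
      by rewrite -/h !intrD rmorphN /=; lra.
    * by rewrite uj !intrD rmorphN /=; lra.
- constructor 1.
  (* The facet nearest to u is the one met by the line of direction e. *)
  pose f (i : 'I_N.+1) := form_val (chain K i) u.
  case: (@arg_minP _ _ _ ord0 predT f isT) => i _ imin.
  apply: (@transversal_probe _ _ _ i u e) => //; first by apply: u0; rewrite -ltnS.
  move=> m; rewrite -val_eqE => mi; apply: (@chain_lt K N) => //.
  + by rewrite -ltnS.
  + by rewrite -ltnS.
  + move=> iN; have := imin (Ordinal (iN : (i.+1 < N.+1)%N)) isT.
    rewrite /f /= chain_succ lerDl subr_ge0 le_eqVlt => /orP[/eqP ui|//].
    by case: nbp; exists i; rewrite ui.
  + case: i imin mi => -[//|i] lti imin mi _ /=.
    have := imin (Ordinal (ltnW lti)) isT.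
    rewrite /f /= chain_succ gerDl subr_le0 le_eqVlt => /orP[/eqP ui|//].
    by case: nbp; exists i; rewrite ui.
Qed.

End Chain.

(** * The resolution polygon as a chain *)

Section ResolutionPolygon.
Context {R : realType} {n : nat}.
Context (kappa : 'rV[R]_n).

(** The constants kappa_j for 1 <= j <= n, extended by zero: the unbounded edges
    x_1 = 0 and - n x_1 + (n + 1) x_2 = 0 have the indices 0 and n + 1. *)
Definition extended_offset (j : nat) : R :=
  if j is i.+1 then oapp (kappa 0) 0 (insub i) else 0.

Lemma extended_offset_ord (i : 'I_n) : extended_offset i.+1 = kappa 0 i.
Proof. by rewrite /= valK. Qed.

Lemma extended_offset_last : extended_offset n.+1 = 0.
Proof. by rewrite /= insubF // ltnn. Qed.

Lemma ell_chain j x : ell j (extended_offset j) x = form_val (chain extended_offset j) x.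
Proof. by rewrite chain_val /ell /shear; ring. Qed.

Lemma ellk_chain (i : 'I_n) x : ellk kappa i x = form_val (chain extended_offset i.+1) x.
Proof. by rewrite /ellk -extended_offset_ord ell_chain. Qed.

Lemma resolution_polygonE :
  resolution_polygon kappa = polyhedron (fun j : 'I_n.+2 => chain extended_offset j).
Proof.
apply/seteqP; split=> x.
- case=> x0 xi xn [[|j] jn].
    by rewrite chain_val /= mul0r !addr0.
  have [jltn|] := ltnP j n; first by have := xi (Ordinal jltn); rewrite ellk_chain.
  move=> nj; have jE : j = n by lia.
  rewrite /= jE chain_val extended_offset_last; move: xn; rewrite /shear -natr1; lra.
- move=> Px; split=> [|i|].
  + by have := Px ord0; rewrite chain_val /= mul0r !addr0.
  + by rewrite ellk_chain; exact: (Px (lift ord0 (widen_ord (leqnSn n) i))).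
  + by have := Px ord_max; rewrite chain_val extended_offset_last /shear /= -natr1; lra.
Qed.

(** On facet k + 1 the form of index k is s_k - shear, with s_k the break point of
    index k; its maximum is attained at the end of the facet with the least
    shear, the vertex over s_(k+1). *)
Lemma exceptional_ray_chain (i k : 'I_n) x : k = i.+1 :> nat ->
  decreasing_breakpoints extended_offset n.+1 ->
  shear x = breakpoint extended_offset k ->
  breakpoint extended_offset k - breakpoint extended_offset k.+1 <= ellk kappa i x ->
  exceptional_ray kappa i k x.
Proof.
move=> ki dec xk high; split.
  by rewrite !ellk_chain -ki chain_succ xk subrr addr0.
set K := extended_offset in dec xk high *.
exists (breakpoint K k - breakpoint K k.+1) => //.
have ik y : ellk kappa k y = 0 -> ellk kappa i y = breakpoint K k - shear y.
  by rewrite !ellk_chain -ki chain_succ; lra.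
have kn1 : (k.+1 < n.+1)%N by rewrite ltnS.
split.
- pose s := breakpoint K k.+1; pose a := - (k.+1%:R * s) - K k.+1.
  pose y : 'rV[R]_2 := \row_j (if j == 0 then a else a + s).
  have sy : shear y = s by rewrite /shear !mxE /=; ring.
  have ky : form_val (chain K k.+1) y = 0 by rewrite chain_val sy mxE eqxx /a; ring.
  have ky' : ellk kappa k y = 0 by rewrite ellk_chain.
  exists y; last by rewrite ik // sy.
  split=> //; rewrite resolution_polygonE => m.
  case: (eqVneq (m : nat) k.+1) => [->|mk]; first by rewrite ky.
  case: (eqVneq (m : nat) k.+2) => [->|mk2].
    by rewrite chain_succ ky sy subrr addr0.
  by rewrite -ky ltW // (@chain_lt_breakpoint _ K n.+1) // -ltnS.
- move=> _ [y [Py ky] <-]; rewrite ik //.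
  move: Py; rewrite resolution_polygonE => /(_ (Ordinal (kn1 : (k.+2 < n.+2)%N))).
  by rewrite /= chain_succ; move: ky; rewrite ellk_chain => ->; lra.
Qed.

End ResolutionPolygon.

Theorem corollary4p5p3 (R : realType) (n : nat) (kappa : 'rV[R]_n)
    (x : 'rV[R]_2) :
  (2 <= n)%N ->
  (forall i : 'I_n, kappa 0 i < 0) ->
  (edges (resolution_polygon kappa) #= `I_n.+2)%card ->
  interior (resolution_polygon kappa) x ->
  (forall i k : 'I_n, k = i.+1 :> nat -> ~ exceptional_ray kappa i k x) ->
  displaceable_by_probes_or_extended_probes (resolution_polygon kappa) x.
Proof.
move=> _ _; rewrite resolution_polygonE => /chain_decreasing dec Px noray.
apply: chain_displaceable => // -[//|i] _ kn xk.
have kn' : (i.+1 < n)%N by [].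
pose io := Ordinal (ltnW kn'); pose ko := Ordinal kn'.
rewrite ltNge; apply/negP => high; apply: (noray io ko) => //.
apply: exceptional_ray_chain => //.
by rewrite ellk_chain.
Qed.
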